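(* Let $\psi_0$ be an admissible scalar penalty, let $\lambda_1\ge\dots\ge\lambda_p\ge0$ with at least one strict inequality, and let $\mathbf{y}\in\mathcal{K}_p^+$. The PAV algorithm (described in the context) based on the update rule $B\mapsto\chi(B)$ finds a local minimizer of the problem $$(P_p)\qquad \min_{\mathbf{x}\in\mathcal{K}_p^+}\ \frac12\|\mathbf{x}-\mathbf{y}\|^2+\sum_{i=1}^p\lambda_i\psi_0(x_i).$$
   Context: $\mathcal{K}_p^+=\{\mathbf{x}\in\mathbb{R}^p: x_1\ge\dots\ge x_p\ge0\}$. Local minimizers of $(P_p)$ are relative to $\mathcal{K}_p^+$. Admissible scalar penalty: $\psi_0:[0,\infty)\to[0,\infty)$ is continuous, non-decreasing and concave, $\psi_0(0)=0$; $\psi_0$ is continuously differentiable on $(0,\infty)$ and $\psi_0'(0):=\lim_{z\to0^+}\psi_0'(z)\in[0,\infty]$; $\psi_0$ is twice differentiable on $(0,\infty)$ except possibly on a finite set $Z_\psi$; the second derivative $\psi_0''$ is increasing, and $\lim_{z\to+\infty}\psi_0''(z)=0$. For $\lambda>0$: $m(\lambda)=\inf\{z\in(0,\infty)\setminus Z_\psi:\psi_0''(z)\ge-1/\lambda\}$ (the function $z\mapsto\frac12(z-y)^2+\lambda\psi_0(z)$ is strictly concave on $[0,m(\lambda)]$ and convex on $[m(\lambda),\infty)$) and $\tau(\lambda)=m(\lambda)+\lambda\psi_0'(m(\lambda))$; at $\lambda=0$ these are read as $m(0)=\tau(0)=0$. For $y\ge\tau(\lambda)$, $\rho^+(y;\lambda)$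 is the minimizer of $z\mapsto\frac12(z-y)^2+\lambda\psi_0(z)$ over the convex region $[m(\lambda),\infty)$. A block is a non-empty set $B=\{q,q+1,\dots,r\}$ of consecutive indices of $\{1,\dots,p\}$; $\bar y_B=\frac1{|B|}\sum_{i\in B}y_i$, $\bar\lambda_B=\frac1{|B|}\sum_{i\in B}\lambda_i$. The update rule is $\chi(B)=\rho^+(\bar y_B;\bar\lambda_B)$ if $\bar y_B\ge\tau(\bar\lambda_B)$, and $\chi(B)=0$ otherwise. PAV algorithm. It maintains a partition of $\{1,\dots,p\}$ into blocks and a vector $\mathbf{x}$ constant on each block $B$, with value $x_B$. $\mathrm{Pred}(B)$ / $\mathrm{Succ}(B)$ denote the block of the current partition just before / after $B$ ($\emptyset$ if none). Initialization: all blocks are singletons, $x_i=\chi(\{i\})$, $B_-=\emptyset$, $B_0=\{1\}$, $B_+=\mathrm{Succ}(B_0)$. While $B_+\ne\emptyset$: if $x_{B_0}\ge x_{B_+}$, set simultaneously $(B_-,B_0,B_+)\leftarrow(B_0,B_+,\mathrm{Succ}(B_+))$; otherwise, replace $B_0$ and $B_+$ in the partition by their union, with value $\chi(B_0\cup B_+)$, let $B_0$ be this union and $B_+\leftarrow\mathrm{Succ}(B_0)$, and then, while $B_-\neq\emptyset$ and $x_{B_-}\le x_{B_0}$, replace $B_-$ and $B_0$ by their union, with value $\chi(B_-\cup B_0)$, let $B_0$ be this union and let $B_-\leftarrow\mathrm{Pred}(B_0)$. Finally return $(\mathbf{x})_+$ (componentwise positive part).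
   Formalization: Added hypothesis: no block B of the final PAV partition has m(λ̄_B)>0 and ȳ_B=τ(λ̄_B). Without it the claim fails, e.g. ψ₀(z)=z−z²/2 on [0,1], 1/2 beyond, λ=(3,2), y=(2,1): PAV returns (2,1), not a local minimizer. *)

(* Defs.v *)
From HB Require Import structures.
From mathcomp Require Import all_boot all_order all_algebra.
From mathcomp Require Import all_classical all_reals all_analysis.
Set Implicit Arguments.
Unset Strict Implicit.
Unset Printing Implicit Defensive.
Import Order.TTheory GRing.Theory Num.Theory.
Import numFieldNormedType.Exports.
Local Open Scope classical_set_scope.
Local Open Scope ring_scope.

Section Problem.
Context {R : realType} {p : nat}.
Implicit Types x y lam : 'rV[R]_p.

Definition Kplus : set 'rV[R]_p :=
  [set x | (forall i j : 'I_p, (i <= j)%N -> x 0 j <= x 0 i) /\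
           (forall i : 'I_p, 0 <= x 0 i)].

(* One of the p inequalities of the chain
   lam_1 >= ... >= lam_p >= 0 (the last one included) is strict. *)
Definition has_strict_ineq lam : Prop :=
  (exists i j : 'I_p, j = i.+1 :> nat /\ lam 0 j < lam 0 i) \/
  (exists i : 'I_p, i.+1 = p /\ 0 < lam 0 i).

(* The norm is Euclidean: the library norm on 'rV[R]_p is the sup norm. *)
Definition objective (psi : R -> R) y lam x : R :=
  2^-1 * (\sum_(i < p) (x 0 i - y 0 i) ^+ 2) + \sum_(i < p) lam 0 i * psi (x 0 i).

End Problem.

(* Minimality of f at x in the intersection of K and a neighborhood of x. *)
Definition local_minimizer {R : realType} {T : topologicalType}
    (K : set T) (f : T -> R) (x : T) : Prop :=
  K x /\ \forall x' \near x, K x' -> f x <= f x'.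

Section ScalarPenalty.
Context {R : realType}.
Implicit Types (psi : R -> R) (Z : set R) (l y z : R).

(* A function on [0, +oo[ is a total function whose values at negative reals
   are irrelevant: below, derivatives are only taken at positive reals. *)
Record admissible psi Z : Prop := Admissible {
  adm_ge0 : forall z, 0 <= z -> 0 <= psi z;
  adm_continuous : {within `[0, +oo[, continuous psi};
  adm_nondecreasing : {in `[0, +oo[ &, {homo psi : z w / z <= w}};
  adm_concave : @convex_function R R^o `[0, +oo[%classic (\- psi);
  adm_0 : psi 0 = 0;
  adm_derivable : forall z, 0 < z -> derivable psi z 1;
  adm_derive1_continuous : forall z, 0 < z -> {for z, continuous (derive1 psi)};
  adm_derive1_0 : exists2 d0 : \bar R, (0 <= d0)%E &
    (derive1 psi z)%:E @[z --> 0^'+] --> d0;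
  adm_finite : finite_set Z;
  adm_derivable2 : forall z, 0 < z -> ~ Z z -> derivable (derive1 psi) z 1;
  adm_derive2_nondecreasing : forall z w, 0 < z -> ~ Z z -> ~ Z w ->
    z <= w -> derive1n 2 psi z <= derive1n 2 psi w;
  adm_derive2_pinfty : derive1n 2 psi z @[z --> +oo] --> (0 : R) }.

(* The derivative on [0, +oo[, with the right limit (possibly +oo) at 0. *)
Definition dpsi psi z : \bar R :=
  if z == 0 then lim ((derive1 psi t)%:E @[t --> 0^'+]) else (derive1 psi z)%:E.

Definition m psi Z l : R :=
  if l == 0 then 0
  else inf [set z | [/\ 0 < z, ~ Z z & - l^-1 <= derive1n 2 psi z]].

Definition tau psi Z l : \bar R :=
  if l == 0 then 0%E else ((m psi Z l)%:E + l%:E * dpsi psi (m psi Z l))%E.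

Definition scalar_obj psi y l z : R := 2^-1 * (z - y) ^+ 2 + l * psi z.

(* For y >= tau l, minimizers exist. They are unique except possibly if
   y = tau l and psi'' = - 1 / l on an interval starting at m l; then an
   arbitrary one, depending only on y and l, is chosen. *)
Definition rho_plus psi Z y l : R :=
  xget 0 [set z | m psi Z l <= z /\
    forall w, m psi Z l <= w -> scalar_obj psi y l z <= scalar_obj psi y l w].

End ScalarPenalty.

Section UpdateRule.
Context {R : realType} {p : nat}.
Implicit Types (psi : R -> R) (Z : set R) (y lam v : 'rV[R]_p) (B : {set 'I_p}).

Definition block_mean v B : R := (\sum_(i in B) v 0 i) / #|B|%:R.

Definition chi psi Z y lam B : R :=
  if (tau psi Z (block_mean lam B) <= (block_mean y B)%:E)%E
  then rho_plus psi Z (block_mean y B) (block_mean lam B) else 0.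

(* B sits exactly at the discontinuity of the update rule. Then (up to the
   choice made in rho_plus) chi B = m > 0, a point which does not minimize the
   block objective locally: this objective is increasing on both sides of m.
   For instance psi z = z - z ^ 2 / 2 on [0, 1] and 1 / 2 on [1, +oo[,
   lam = (3, 2) and y = (2, 1): the rule returns (2, 1), but decreasing the
   second coordinate decreases the objective. *)
Definition at_jump psi Z y lam B : Prop :=
  0 < m psi Z (block_mean lam B) /\
  (block_mean y B)%:E = tau psi Z (block_mean lam B).

End UpdateRule.

Section PAV.
Context {R : realType} {p : nat} (upd : {set 'I_p} -> R).

(* A block B of the current partition together with its value x_B. *)
Definition cell : Type := ({set 'I_p} * R)%type.
Implicit Types (c : cell) (before after : seq cell).

Definition mk_cell (B : {set 'I_p}) : cell := (B, upd B).

Definition merge c c' : cell := mk_cell (c.1 :|: c'.1).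

(* The current partition, in increasing order of the indices, is
   rev before ++ c :: after, where c is B_0. Hence B_- = Pred B_0 is the head
   of before and B_+ = Succ B_0 is the head of after (the empty set when
   these lists are empty). *)

(* Inner loop: while B_- is non-empty and x_(B_-) <= x_(B_0), merge them. *)
Fixpoint pav_back before c : seq cell * cell :=
  if before is cm :: before' then
    if cm.2 <= c.2 then pav_back before' (merge cm c) else (before, c)
  else (before, c).

(* Outer loop; each iteration consumes one cell of after. *)
Fixpoint pav_loop before c after : seq cell :=
  if after is cp :: after' then
    if cp.2 <= c.2 then pav_loop (c :: before) cp after'
    else let: (before', c') := pav_back before (merge c cp) in
         pav_loop before' c' after'
  else rev (c :: before).

Definition pav_partition : seq cell :=
  if [seq mk_cell [set i] | i <- enum 'I_p] is c :: after
  then pav_loop [::] c after else [::].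

(* Each i lies in exactly one block of the partition, so the sum has exactly
   one term: the positive part of the value of that block. *)
Definition pav : 'rV[R]_p :=
  \row_(i < p) \sum_(c <- pav_partition | i \in c.1) Num.max 0 c.2.

End PAV.

(* Main.v *)
Require Import Defs.
From mathcomp Require Import all_boot all_order all_algebra.
From mathcomp Require Import all_classical all_reals all_analysis.
From mathcomp Require Import ring lra.
Set Implicit Arguments.
Unset Strict Implicit.
Unset Printing Implicit Defensive.
Import Order.TTheory GRing.Theory Num.Theory.
Import numFieldNormedType.Exports.
Local Open Scope classical_set_scope.
Local Open Scope ring_scope.

(* For a set P of indices let g_P(z) be the sum over i in P of
   z - y_i + lam_i psi'(z), the derivative of the objective along the constant
   vectors on P. A merge of adjacent blocks B1, B2 with
   chi(B1) <= chi(B2) preserves the following invariant of a block B: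
   g_P >= 0 on [chi(B), +oo[ for every prefix P of B. Two facts are behind
   this: z + l psi'(z) is non-increasing up to m(l) and non-decreasing after it,
   and, psi' being non-increasing, if it does not increase between two points
   for some l, it does not for any larger l (prefixes have larger means of lam).
   On a final block with v = chi(B) > 0, the absence of a jump yields
   v > m, and g_B(v) = 0 turns the invariant into g_S <= 0 on [m, v] for
   every suffix S of B. Any x in K_p^+ near the output is non-increasing on B,
   so summation by parts bounds the objective of max(x, v) below with the
   prefixes and that of min(x, v) with the suffixes. *)

(** * The scalar penalty *)

(** [psi'] is known to be differentiable only off the finite set [Z]. The induction on the
    exceptional points cuts the interval at each one that falls strictly inside it. *)
Lemma le_derive1_ge0_except (R : realType) (f : R -> R) (s : seq R) (u w : R) :
  u <= w -> {within `[u, w], continuous f} ->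
  (forall z, u < z < w -> z \notin s -> derivable f z 1 /\ 0 <= derive1 f z) ->
  f u <= f w.
Proof.
elim: s u w => [|t s IH] u w.
  rewrite le_eqVlt => /predU1P[->//|uw] cf df.
  have dfuw z : z \in `]u, w[ -> derivable f z 1 /\ 0 <= derive1 f z.
    by rewrite in_itv => zuw; exact: df.
  apply: (@ger0_derive1_le_cc _ f u w) => //; rewrite ?in_itv/= ?lexx ?(ltW uw)//.
    by move=> z /dfuw[].
  by move=> z /dfuw[].
move=> uw cf df.
have [/andP[ut tw]|nt] := boolP (u < t < w).
  apply: (@le_trans _ _ (f t)); apply: IH; rewrite ?(ltW ut) ?(ltW tw)//.
  - apply: continuous_subspaceW cf => x /=; rewrite !in_itv/= => /andP[-> xt].
    exact: le_trans xt (ltW tw).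
  - move=> z /andP[uz zt] zs; apply: df; first by rewrite uz (lt_trans zt).
    by rewrite inE negb_or zs (lt_eqF zt).
  - apply: continuous_subspaceW cf => x /=; rewrite !in_itv/= => /andP[tx ->].
    by rewrite (le_trans (ltW ut)).
  - move=> z /andP[tz zw] zs; apply: df; first by rewrite zw (lt_trans ut).
    by rewrite inE negb_or zs (gt_eqF tz).
apply: IH => // z zuw zs; apply: df => //.
by rewrite inE negb_or zs andbT; apply: contraNneq nt => <-.
Qed.

Lemma finite_set_near_pinfty (R : realType) (Z : set R) :
  finite_set Z -> \forall z \near +oo, ~ Z z.
Proof.
move=> /finite_seqP[s ->]; elim: s => [|t s IH]; first by near=> z.
near=> z => /=; rewrite inE => /orP[/eqP zt|]; last exact: (near IH z).
have : t < z by near: z; apply: nbhs_pinfty_gt; exact: num_real.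
by rewrite zt ltxx.
Unshelve. all: by end_near. Qed.

Section Penalty.
Context {R : realType} (psi : R -> R) (Z : set R) (hpsi : admissible psi Z).
Implicit Types a b l y z u w : R.

(* z > 0 is a stationary point of scalar_obj psi y l iff y = stat_input l z. *)
Definition stat_input l z : R := z + l * derive1 psi z.

(** Off [Z], [psi''] is non-decreasing, so a positive value would keep it away from its limit 0 at
    infinity. *)
Lemma derive2_le0 z : 0 < z -> ~ Z z -> derive1n 2 psi z <= 0.
Proof.
move=> z0 nZ; rewrite leNgt; apply/negP => pos.
have := adm_derive2_pinfty hpsi => /(@cvgrPdist_lt _ _ _ _ _) /(_ _ pos) H.
have [w [zw nZw]] : exists w, [/\ z <= w, ~ Z w & `|0 - derive1n 2 psi w| < derive1n 2 psi z].
  near (pinfty_nbhs R) => w; exists w; split.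
  - by near: w; apply: nbhs_pinfty_ge; exact: num_real.
  - near: w; apply: finite_set_near_pinfty; exact: adm_finite hpsi.
  - by near: w.
have le := adm_derive2_nondecreasing hpsi z0 nZ nZw zw.
by rewrite sub0r normrN ger0_norm ?(le_trans (ltW pos))// ltNge le.
Unshelve. all: by end_near. Qed.

Lemma continuous_stat l z : 0 < z -> {for z, continuous (stat_input l)}.
Proof.
move=> z0; apply: cvgD; first exact: cvg_id.
by apply: cvgM; [exact: cvg_cst|exact: adm_derive1_continuous hpsi _ z0].
Qed.

Lemma is_derive_stat l z : 0 < z -> ~ Z z ->
  is_derive z 1 (stat_input l) (1 + l * derive1n 2 psi z).
Proof.
move=> z0 nZ.
have d2 : is_derive z 1 (derive1 psi) (derive1n 2 psi z).
  have := adm_derivable2 hpsi z0 nZ => /derivableP.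
  by rewrite -derive1E.
exact: is_deriveD.
Qed.

Lemma within_continuous_pos (f : R -> R) u w :
  0 < u -> (forall z, 0 < z -> {for z, continuous f}) -> {within `[u, w], continuous f}.
Proof.
move=> u0 cf; apply: continuous_in_subspaceT => z /set_mem/=.
by rewrite in_itv/= => /andP[uz _]; apply: cf; exact: lt_le_trans uz.
Qed.

Lemma le_stat l u w : 0 < u -> u <= w ->
  (forall z, u < z < w -> ~ Z z -> 0 <= 1 + l * derive1n 2 psi z) ->
  stat_input l u <= stat_input l w.
Proof.
move=> u0 uw H; have /finite_seqP[s Zs] := adm_finite hpsi.
apply: (@le_derive1_ge0_except _ _ s) => //.
  by apply: within_continuous_pos => // z; exact: continuous_stat.
move=> z zuw /negP zs; have nZ : ~ Z z by rewrite Zs.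
have z0 : 0 < z by case/andP: zuw => uz _; exact: lt_trans uz.
have D := is_derive_stat l z0 nZ; split; first exact: ex_derive.
by rewrite derive1E derive_val; exact: H.
Qed.

Lemma ge_stat l u w : 0 < u -> u <= w ->
  (forall z, u < z < w -> ~ Z z -> 1 + l * derive1n 2 psi z <= 0) ->
  stat_input l w <= stat_input l u.
Proof.
move=> u0 uw H; have /finite_seqP[s Zs] := adm_finite hpsi.
rewrite -lerN2.
apply: (@le_derive1_ge0_except _ (\- stat_input l) s) => //.
  apply: within_continuous_pos => // z z0; apply: cvgN; exact: continuous_stat.
move=> z zuw /negP zs; have nZ : ~ Z z by rewrite Zs.
have z0 : 0 < z by case/andP: zuw => uz _; exact: lt_trans uz.
have D := is_deriveN (is_derive_stat l z0 nZ).
split; first exact: (@ex_derive _ _ _ _ _ _ _ D).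
by rewrite derive1E (@derive_val _ _ _ _ _ _ _ D) oppr_ge0; exact: H.
Qed.

Lemma derive1_nonincreasing u w : 0 < u -> u <= w -> derive1 psi w <= derive1 psi u.
Proof.
move=> u0 uw; rewrite -lerN2; have /finite_seqP[s Zs] := adm_finite hpsi.
apply: (@le_derive1_ge0_except _ (\- (derive1 psi)) s) => //.
  apply: within_continuous_pos => // z z0.
  by apply: cvgN; exact: adm_derive1_continuous hpsi _ z0.
move=> z zuw /negP zs; have nZ : ~ Z z by rewrite Zs.
have z0 : 0 < z by case/andP: zuw => uz _; exact: lt_trans uz.
have d2 := adm_derivable2 hpsi z0 nZ; split; first exact: derivableN.
by rewrite derive1E deriveN// oppr_ge0 -derive1E; exact: derive2_le0.
Qed.

Lemma m_ge0 l : 0 <= m psi Z l.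
Proof.
rewrite /m; case: eqP => // _; set A := [set _ | _].
(* The infimum of the empty set is 0 by default. *)
have [->|/set0P A0] := eqVneq A set0; first by rewrite inf0.
by apply: lb_le_inf => // w [/ltW].
Qed.

Lemma m_has_inf l : 0 < l -> has_inf [set z | [/\ 0 < z, ~ Z z & - l^-1 <= derive1n 2 psi z]].
Proof.
move=> l0; split; last by exists 0 => z [/ltW].
have l1 : 0 < l^-1 by rewrite invr_gt0.
have := adm_derive2_pinfty hpsi => /(@cvgrPdist_lt _ _ _ _ _) /(_ _ l1) H.
near (pinfty_nbhs R) => w; exists w; split.
- by near: w; apply: nbhs_pinfty_gt; exact: num_real.
- near: w; apply: finite_set_near_pinfty; exact: adm_finite hpsi.
- rewrite lerNl; apply: ltW; apply: le_lt_trans (_ : `|0 - derive1n 2 psi w| < _); last by near: w.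
  by rewrite sub0r ler_norm.
Unshelve. all: by end_near. Qed.

(** Any point right of the infimum [m psi Z l] exceeds some member of the defining set, and
    monotonicity of [psi''] carries the bound [- l^-1] over from that member. *)
Lemma stat_nondecreasing l u w : 0 <= l -> m psi Z l <= u -> 0 < u -> u <= w ->
  stat_input l u <= stat_input l w.
Proof.
move=> l0 mu u0 uw; apply: le_stat => // z /andP[uz _] nZ.
have [->|ln0] := eqVneq l 0; first by rewrite mul0r addr0.
have lp : 0 < l by rewrite lt0r ln0.
have := le_lt_trans mu uz.
rewrite /m (negbTE ln0) => /(inf_lt (proj1 (m_has_inf lp)))[a [a0 nZa ha]] az.
have := adm_derive2_nondecreasing hpsi a0 nZa nZ (ltW az).
move=> /(le_trans ha); rewrite -(ler_pM2l lp) mulrN divff// => h.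
by rewrite -lerBlDl sub0r.
Qed.

(** Off [Z], positive points left of the infimum are outside its set, so [psi'' < - l^-1] there. For
    [l = 0] the range is empty, since [m] is 0. *)
Lemma stat_nonincreasing l u w : 0 <= l -> 0 < u -> u <= w -> w <= m psi Z l ->
  stat_input l w <= stat_input l u.
Proof.
move=> l0 u0 uw wm; apply: ge_stat => // z /andP[uz zw] nZ.
have := lt_le_trans zw wm; rewrite /m; case: eqP => [_|/eqP ln0 zm].
  by rewrite ltNge (ltW (lt_trans u0 uz)).
have lp : 0 < l by rewrite lt0r ln0.
have : derive1n 2 psi z < - l^-1.
  rewrite ltNge; apply/negP => h; move: zm; rewrite ltNge => /negP; apply.
  by apply: ge_inf; [exact: (proj2 (m_has_inf lp))|split => //; exact: lt_trans uz].
rewrite -(ltr_pM2l lp) mulrN divff// => /ltW h.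
by rewrite -lerBrDl sub0r.
Qed.
End Penalty.

(** * The scalar update rule *)

Section Prox.
Context {R : realType} (psi : R -> R) (Z : set R) (hpsi : admissible psi Z).
Implicit Types a b l y z u w : R.

(** With free coefficients, this family contains, up to a constant, the objective of a block on
    constant vectors ([sum_scalar_obj]), and it is closed under negation ([ge_quad_obj]). *)
Definition quad_obj a b l z : R := a * (2^-1 * z ^+ 2) - b * z + l * psi z.

Lemma scalar_objE y l z : scalar_obj psi y l z = quad_obj 1 y l z + 2^-1 * y ^+ 2.
Proof. by rewrite /scalar_obj /quad_obj; field. Qed.

Lemma is_derive_quad_obj a b l z : 0 < z ->
  is_derive z 1 (quad_obj a b l) (a * z - b + l * derive1 psi z).
Proof.
move=> z0; have D : is_derive z 1 psi (derive1 psi z).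
  by rewrite derive1E; exact/derivableP/(adm_derivable hpsi).
have -> : quad_obj a b l =
    (a * 2^-1) *: (id : R -> R) ^+ 2 - b *: (id : R -> R) + l *: psi.
  by apply/funext => x; rewrite /quad_obj !fctE /= /GRing.scale/= mulrA.
have H := is_deriveD (is_deriveB
  (is_deriveZ (a / 2) (is_deriveX 2 (is_derive_id z 1)))
  (is_deriveZ b (is_derive_id z 1))) (is_deriveZ l D).
apply: (@is_derive_eq _ _ _ _ _ _ _ _ H).
by rewrite /GRing.scale/= expr1; field.
Qed.

Lemma within_continuous_quad_obj a b l u w : 0 <= u ->
  {within `[u, w], continuous (quad_obj a b l)}.
Proof.
move=> u0.
have cpsi : {within `[u, w], continuous psi}.
  apply: continuous_subspaceW (adm_continuous hpsi) => x /=.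
  by rewrite !in_itv/= andbT => /andP[ux _]; exact: le_trans ux.
have cid : {within `[u, w], continuous (id : R -> R)}.
  by apply: continuous_subspaceT => ?; exact: cvg_id.
have -> : quad_obj a b l =
    (fun z => a * (2^-1 * (z * z)) + (- b) * z + l * psi z).
  by apply/funext => x; rewrite /quad_obj expr2 mulNr.
have cM (f g : R -> R) : {within `[u, w], continuous f} ->
    {within `[u, w], continuous g} -> {within `[u, w], continuous (fun z => f z * g z)}.
  by move=> cf cg x; apply: cvgM; [exact: cf|exact: cg].
have cC (c : R) : {within `[u, w], continuous (fun=> c)}.
  by move=> x; exact: cvg_cst.
have cD (f g : R -> R) : {within `[u, w], continuous f} ->
    {within `[u, w], continuous g} -> {within `[u, w], continuous (fun z => f z + g z)}.
  by move=> cf cg x; apply: cvgD; [exact: cf|exact: cg].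
apply: (cD (fun z => a * (2^-1 * (z * z)) + (- b) * z) (fun z => l * psi z)).
  apply: (cD (fun z => a * (2^-1 * (z * z))) (fun z => (- b) * z)).
    apply: (cM (fun=> a) (fun z => 2^-1 * (z * z))) => //.
    by apply: (cM (fun=> 2^-1) (fun z => z * z)) => //; exact: (cM id id).
  exact: (cM (fun=> - b) id).
exact: (cM (fun=> l) psi).
Qed.

Lemma le_quad_obj a b l u w : 0 <= u -> u <= w ->
  (forall z, u < z < w -> 0 <= a * z - b + l * derive1 psi z) ->
  quad_obj a b l u <= quad_obj a b l w.
Proof.
move=> u0 uw H; apply: (@le_derive1_ge0_except _ (quad_obj a b l) [::] u w uw).
  exact: within_continuous_quad_obj.
move=> z zuw _; have z0 : 0 < z by case/andP: zuw => uz _; exact: le_lt_trans uz.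
have D := is_derive_quad_obj a b l z0; split; first exact: (@ex_derive _ _ _ _ _ _ _ D).
by rewrite derive1E (@derive_val _ _ _ _ _ _ _ D); exact: H.
Qed.

Lemma ge_quad_obj a b l u w : 0 <= u -> u <= w ->
  (forall z, u < z < w -> a * z - b + l * derive1 psi z <= 0) ->
  quad_obj a b l w <= quad_obj a b l u.
Proof.
move=> u0 uw H; rewrite -lerN2.
have N z : - quad_obj a b l z = quad_obj (- a) (- b) (- l) z.
  by rewrite /quad_obj; ring.
rewrite !N; apply: le_quad_obj => // z zuw; have := H z zuw; lra.
Qed.

(** [xget] does not fall back on its default: a minimum exists on the compact interval from [m] to
    [M], and to the right of [M >= y] neither term of the objective decreases. *)
Lemma rho_plus_min y l : 0 <= l -> m psi Z l <= rho_plus psi Z y l /\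
  forall w, m psi Z l <= w ->
    scalar_obj psi y l (rho_plus psi Z y l) <= scalar_obj psi y l w.
Proof.
move=> l0; rewrite /rho_plus; set S := [set z | _].
suff : exists z, S z by exact: xgetPex.
have m0 := m_ge0 psi Z l.
set M := Num.max (m psi Z l) y.
have mM : m psi Z l <= M by rewrite le_max lexx.
have [c cmM cmin] := EVT_min mM (@within_continuous_quad_obj 1 y l _ M m0).
exists c; split; first by move: cmM; rewrite in_itv => /andP[].
move=> w mw; rewrite !scalar_objE lerD2r.
have [wM|Mw] := leP w M; first by apply: cmin; rewrite in_itv/= mw.
apply: le_trans (cmin M _) _; first by rewrite in_itv/= mM lexx.
have yM : y <= M by rewrite le_max lexx orbT.
have psiMw : psi M <= psi w.
  apply: (adm_nondecreasing hpsi); rewrite ?in_itv/= ?andbT ?(ltW Mw)//.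
    exact: le_trans mM.
  by apply: le_trans (ltW Mw); exact: le_trans mM.
rewrite -(lerD2r (2^-1 * y ^+ 2)) -!scalar_objE /scalar_obj lerD//; last first.
  exact: ler_wpM2l.
rewrite ler_pM2l// ler_pXn2r// ?nnegrE ?subr_ge0//; last exact: le_trans (ltW Mw).
by rewrite lerD2r ltW.
Qed.

Lemma tauE l : m psi Z l != 0 -> tau psi Z l = (stat_input psi l (m psi Z l))%:E.
Proof.
rewrite /tau /dpsi => m0; rewrite (negbTE m0).
by case: eqP => // l0; move: m0; rewrite /m l0 eqxx eqxx.
Qed.

(** When [m > 0], [tau] is the value of [stat_input] at its turning point [m]; when [m = 0], it is
    bounded through the limit at 0. *)
Lemma tau_le_stat l z : 0 <= l -> 0 < z -> (tau psi Z l <= (stat_input psi l z)%:E)%E.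
Proof.
move=> l0 z0; have mz := m_ge0 psi Z l.
have [m0|m0] := eqVneq (m psi Z l) 0; last first.
  rewrite tauE// lee_fin; have mp : 0 < m psi Z l by rewrite lt0r m0.
  have [zm|/ltW zm] := leP z (m psi Z l).
    exact: (stat_nonincreasing hpsi).
  exact: (stat_nondecreasing hpsi).
rewrite /tau; case: eqP => [->|/eqP ln0].
  by rewrite lee_fin /stat_input mul0r addr0 ltW.
have lp : 0 < l by rewrite lt0r ln0.
rewrite m0 /dpsi eqxx add0e.
have [d0 _ /cvgP cd] := adm_derive1_0 hpsi.
have -> : (stat_input psi l z)%:E = (l%:E * (l^-1 * stat_input psi l z)%:E)%E.
  by rewrite -EFinM mulrA divff// mul1r.
rewrite lee_pmul2l//; apply: lime_le => //.
near=> t; rewrite lee_fin -(ler_pM2l lp) mulrA divff// mul1r.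
have t0 : 0 < t by near: t; exact: nbhs_right_gt.
apply: (@le_trans _ _ (stat_input psi l t)); first by rewrite /stat_input lerDr ltW.
apply: (stat_nondecreasing hpsi) => //; first by rewrite m0 ltW.
by near: t; exact: nbhs_right_le.
Unshelve. all: by end_near. Qed.

Definition prox y l : R :=
  if (tau psi Z l <= y%:E)%E then rho_plus psi Z y l else 0.

Lemma prox_ge0 y l : 0 <= l -> 0 <= prox y l.
Proof.
move=> l0; rewrite /prox; case: ifP => // _.
by apply: le_trans (m_ge0 psi Z l) _; case: (rho_plus_min y l0).
Qed.

(** Below the threshold this is [tau_le_stat]. Otherwise, a negative derivative to the right of the
    minimizer would, by convexity, make the objective drop below its minimum. *)
Lemma prox_le_stat y l z : 0 <= l -> 0 < z -> prox y l <= z -> y <= stat_input psi l z.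
Proof.
move=> l0 z0; rewrite /prox; case: ifP => [_|/negbT]; last first.
  rewrite -ltNge => yt _; rewrite -lee_fin.
  by rewrite (le_trans (ltW yt))// tau_le_stat.
have [] := rho_plus_min y l0; set u := rho_plus _ _ _ _ => mu umin.
have u0 : 0 <= u by apply: le_trans mu; exact: m_ge0.
have gt_u w : u < w -> y <= stat_input psi l w.
  move=> uw; rewrite leNgt; apply/negP => wy.
  pose d x := 1 * x - y + l * derive1 psi x.
  have dq x : x \in `]u, w[ -> is_derive x 1 (quad_obj 1 y l) (d x).
    by rewrite in_itv => /andP[ux _]; apply: is_derive_quad_obj; exact: le_lt_trans ux.
  have [c] := MVT uw dq (@within_continuous_quad_obj 1 y l u w u0).
  rewrite in_itv/= => /andP[uc cw] e.
  have : 0 <= quad_obj 1 y l w - quad_obj 1 y l u.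
    have := umin w (le_trans mu (ltW uw)).
    by rewrite !scalar_objE lerD2r subr_ge0.
  rewrite e pmulr_lge0 ?subr_gt0// /d => h.
  have := stat_nondecreasing hpsi l0 (le_trans mu (ltW uc)) (le_lt_trans u0 uc) (ltW cw).
  by move: wy h; rewrite /stat_input; lra.
rewrite le_eqVlt => /predU1P[uz|]; last exact: gt_u.
(* At [z = u] itself, the bound passes to the limit from the right. *)
rewrite leNgt; apply/negP => zy.
have := @continuous_stat _ _ _ hpsi l z z0 => /cvgr_lt/(_ _ zy) H.
have [w [zw]] : exists w, z < w /\ stat_input psi l w < y.
  near z^'+ => w; exists w; split; first by near: w; exact: nbhs_right_gt.
  by near: w; apply: cvg_within; exact: H.
by rewrite ltNge gt_u// uz.
Unshelve. all: by end_near. Qed.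

(** An interior minimizer has derivative zero; at the boundary [m] the inequality is the test
    [tau <= y]. The last item lets [m_lt_chi] recognise a jump. *)
Lemma prox_gt0 y l : 0 <= l -> 0 < prox y l ->
  [/\ m psi Z l <= prox y l, stat_input psi l (prox y l) <= y &
    prox y l = m psi Z l -> tau psi Z l = (stat_input psi l (prox y l))%:E].
Proof.
move=> l0; rewrite /prox; case: ifP => [ty|_]; last by rewrite ltxx.
have [] := rho_plus_min y l0; set u := rho_plus _ _ _ _ => mu umin u0.
have um : u = m psi Z l -> tau psi Z l = (stat_input psi l u)%:E.
  by move=> um; rewrite um tauE// -um gt_eqF.
split => //; move: mu; rewrite le_eqVlt => /predU1P[/esym/um tu|mu].
  by rewrite -lee_fin -tu.
have uu1 : u < u + 1 by rewrite ltrDl.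
have e : is_derive u 1 (quad_obj 1 y l) 0.
  apply: (@derive1_at_min _ _ (m psi Z l) (u + 1)).
  - exact: ltW (lt_trans mu uu1).
  - move=> t; rewrite in_itv/= => /andP[mt _].
    have t0 : 0 < t by apply: le_lt_trans mt; exact: m_ge0.
    exact: (@ex_derive _ _ _ _ _ _ _ (is_derive_quad_obj 1 y l t0)).
  - by rewrite in_itv/= mu uu1.
  - move=> t; rewrite in_itv/= => /andP[mt _].
    by have := umin t (ltW mt); rewrite !scalar_objE lerD2r.
have := @derive_val _ _ _ _ _ _ _ (is_derive_quad_obj 1 y l u0).
by rewrite (@derive_val _ _ _ _ _ _ _ e) /stat_input; lra.
Qed.
End Prox.

(** * The PAV algorithm *)

Section PavInvariant.
Context {R : realType} {p : nat} (upd : {set 'I_p} -> R) (good : {set 'I_p} -> Prop).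
Implicit Types (B : {set 'I_p}) (c : @cell R p) (s before after : seq (@cell R p)).

Definition set_lt B B' := [forall i in B, forall j in B', (i < j)%N].

Lemma set_ltP B B' : reflect {in B & B', forall i j : 'I_p, (i < j)%N} (set_lt B B').
Proof.
apply: (iffP forall_inP) => [H i j iB jB'|H i iB].
  by have /forall_inP := H i iB; exact.
by apply/forall_inP => j; exact: H.
Qed.

Lemma set_ltUl B1 B2 B : set_lt (B1 :|: B2) B = set_lt B1 B && set_lt B2 B.
Proof.
apply/set_ltP/andP => [H|[/set_ltP H1 /set_ltP H2] i j].
  by split; apply/set_ltP => i j iB; apply: H; rewrite inE iB ?orbT.
by rewrite inE => /orP[]; [exact: H1|exact: H2].
Qed.

Lemma set_ltUr B1 B2 B : set_lt B (B1 :|: B2) = set_lt B B1 && set_lt B B2.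
Proof.
apply/set_ltP/andP => [H|[/set_ltP H1 /set_ltP H2] i j iB].
  by split; apply/set_ltP => i j iB jB; apply: H => //; rewrite inE jB ?orbT.
by rewrite inE => /orP[]; [exact: H1|exact: H2].
Qed.

(** Covering and pairwise [set_lt] together force the cells to be disjoint intervals, so no separate
    clause is needed for this. *)
Definition ordered_cells s :=
  [/\ forall c, c \in s -> c.2 = upd c.1 /\ good c.1,
      pairwise (fun c c' => set_lt c.1 c'.1) s &
      forall i, exists2 c, c \in s & i \in c.1].

Hypothesis good1 : forall i, good [set i].
Hypothesis goodU : forall B1 B2, good B1 -> good B2 -> set_lt B1 B2 ->
  upd B1 <= upd B2 -> good (B1 :|: B2).

Lemma ordered_cells_merge s1 c c' s2 : ordered_cells (s1 ++ c :: c' :: s2) ->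
  c.2 <= c'.2 -> ordered_cells (s1 ++ Defs.merge upd c c' :: s2).
Proof.
move=> [G O C] le.
have [ec gc] : c.2 = upd c.1 /\ good c.1 by apply: G; rewrite mem_cat mem_head orbT.
have [ec' gc'] : c'.2 = upd c'.1 /\ good c'.1.
  by apply: G; rewrite mem_cat !inE eqxx !orbT.
move: O; rewrite pairwise_cat allrel_consr allrel_consr /=.
case/and3P=> /and3P[s1c s1c' s1s2] ps1 /and3P[/andP[cc' cs2] c's2 ps2].
split.
- move=> d; rewrite mem_cat inE => /or3P[ds1|/eqP->|ds2].
  + by apply: G; rewrite mem_cat ds1.
  + by split => //; apply: goodU => //; rewrite -ec -ec'.
  + by apply: G; rewrite mem_cat !inE ds2 !orbT.
- rewrite pairwise_cat allrel_consr /= ps1 ps2 s1s2 !andbT.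
  apply/andP; split; apply/allP => d ds /=; rewrite ?set_ltUl ?set_ltUr.
    by rewrite (allP s1c)// (allP s1c').
  by rewrite (allP cs2)// (allP c's2).
- move=> i; have [d + id] := C i; rewrite mem_cat !inE => /or4P[ds|/eqP e|/eqP e|ds].
  + by exists d; rewrite // mem_cat ds.
  + by exists (Defs.merge upd c c'); rewrite ?mem_cat ?mem_head ?orbT//= inE -e id.
  + by exists (Defs.merge upd c c'); rewrite ?mem_cat ?mem_head ?orbT//= inE -e id orbT.
  + by exists d; rewrite // mem_cat inE ds !orbT.
Qed.

(** [before] is stored in reverse, so non-increasing block values appear there as non-decreasing. *)
Let le_val c c' := c.2 <= c'.2.

Lemma pav_back_ordered before c after :
  ordered_cells (rev before ++ c :: after) -> sorted le_val before ->
  let: (before', c') := pav_back upd before c in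
  ordered_cells (rev before' ++ c' :: after) /\ sorted le_val (c' :: before').
Proof.
elim: before c => [//|cm before IH] c H S /=.
case: leP => [le|lt]; last by split => //=; rewrite /le_val ltW.
apply: IH; last exact: path_sorted S.
by apply: ordered_cells_merge => //; rewrite rev_cons cat_rcons in H.
Qed.

Lemma pav_loop_ordered before c after :
  ordered_cells (rev before ++ c :: after) -> sorted le_val (c :: before) ->
  ordered_cells (pav_loop upd before c after) /\
  sorted (fun c c' => c'.2 <= c.2) (pav_loop upd before c after).
Proof.
elim: after before c => [|cp after IH] before c H S /=.
  by rewrite rev_sorted; split => //; rewrite rev_cons -cats1.
case: leP => [le|lt].
  by apply: IH; [rewrite rev_cons cat_rcons|rewrite /= /le_val le].
have H' := ordered_cells_merge H (ltW lt).
(* The merged value may exceed that of the head of [before], so only [before] itself is known to be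
   sorted; the inner loop restores the order. *)
have := pav_back_ordered H' (path_sorted S).
by case: pav_back => before' c' [H2 S2]; exact: IH.
Qed.

Lemma pav_partition_ordered : ordered_cells (pav_partition upd) /\
  sorted (fun c c' => c'.2 <= c.2) (pav_partition upd).
Proof.
have : ordered_cells [seq mk_cell upd [set i] | i <- enum 'I_p].
  split.
  - by move=> c /mapP[i _ ->]; split => /=.
  - rewrite pairwise_map.
    have : pairwise ltn (map val (enum 'I_p)).
      rewrite val_enum_ord; rewrite -(sorted_pairwise ltn_trans); exact: iota_ltn_sorted.
    rewrite pairwise_map; apply: sub_pairwise => i j /= ij.
    by apply/set_ltP => i' j' /set1P-> /set1P->.
  - move=> i; exists (mk_cell upd [set i]); last by rewrite /= inE.
    by apply/mapP; exists i; rewrite ?mem_enum.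
rewrite /pav_partition; case: map => [|c after] H; first by split.
exact: (@pav_loop_ordered [::]).
Qed.

(** No index lies in two cells. Arbitrary weights [K] serve to read off [pav], to regroup sums by
    blocks and, with an indicator, to identify the cell of an index. *)
Lemma ordered_sum s (K : @cell R p -> R) c i :
  pairwise (fun c c' => set_lt c.1 c'.1) s -> c \in s -> i \in c.1 ->
  \sum_(d <- s | i \in d.1) K d = K c.
Proof.
elim: s => [//|d s IH] /= /andP[ds ps].
rewrite inE big_cons => /predU1P[->|cs] ic.
  rewrite ic big_seq_cond big1 ?addr0// => e /andP[es ie].
  by have /set_ltP/(_ _ _ ic ie) := allP ds _ es; rewrite ltnn.
case: ifPn => [id|_]; last exact: IH.
by have /set_ltP/(_ _ _ id ic) := allP ds _ cs; rewrite ltnn.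
Qed.

Lemma ordered_val s c c' (i j : 'I_p) :
  pairwise (fun c c' => set_lt c.1 c'.1) s -> sorted (fun c c' => c'.2 <= c.2) s ->
  c \in s -> c' \in s -> i \in c.1 -> j \in c'.1 -> (i <= j)%N -> c'.2 <= c.2.
Proof.
rewrite sorted_pairwise; last by move=> a b d ba db; exact: le_trans ba.
elim: s => [//|d s IH] /= /andP[ds ps] /andP[vs qs].
rewrite !inE => /predU1P[->|cs] /predU1P[->|c's] ic jc' ij //.
- exact: (allP vs).
- by have /set_ltP/(_ _ _ jc' ic) := allP ds _ cs; rewrite ltnNge ij.
- exact: IH.
Qed.
End PavInvariant.

(** * Summation by parts along a ranking *)

Section Sections.
Context {R : realType} {I : finType} (k : I -> nat).
Implicit Types P B : {set I}.

(** The rank [k] is free so that one lemma serves prefixes ([k i = i]) and suffixes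
    ([k i = p - i]). *)
Definition initial P B :=
  P \subset B /\ forall i j, i \in P -> j \in B -> (k j < k i)%N -> j \in P.

Lemma initial_refl B : initial B B.
Proof. by []. Qed.

(* Summation by parts, carried out by removing the element of largest rank. *)
Lemma sum_le_initial (F : I -> R -> R) (r : R -> R -> Prop) B v (x : I -> R) :
  (forall P a b, initial P B -> r a b -> \sum_(i in P) F i a <= \sum_(i in P) F i b) ->
  (forall i, i \in B -> r v (x i)) ->
  (forall i j, i \in B -> j \in B -> (k i <= k j)%N -> r (x j) (x i)) ->
  \sum_(i in B) F i v <= \sum_(i in B) F i (x i).
Proof.
have [n] := ubnP #|B|; elim: n B v => // n IH B v Bn mono start chain.
have [->|[j0 j0B]] := set_0Vmem B; first by rewrite !big_set0.
case: (arg_maxnP k j0B) => j jB0 jmax0.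
have jB : j \in B := jB0; have jmax i : i \in B -> (k i <= k j)%N := jmax0 i.
(* Moving all of [B] from [v] to [x j] settles the index [j] of largest rank. The rest continues
   from [x j], and its initial sections are still initial in [B]. *)
apply: le_trans (mono B v (x j) (initial_refl B) (start j jB)) _.
rewrite (big_setD1 j jB) [leRHS](big_setD1 j jB)/= lerD2l.
have sub : {subset B :\ j <= B} by move=> i; rewrite !inE => /andP[].
apply: IH.
- by move: Bn; rewrite (cardsD1 j) jB.
- move=> P a b [PB Pini] rab; apply: mono rab; split; first exact: fintype.subset_trans PB (subD1set _ _).
  move=> i i' iP i'B ii'; apply: (Pini i i') => //; rewrite !inE i'B andbT.
  apply: contraTneq ii' => ->; rewrite -leqNgt; apply: jmax.
  apply: sub; exact: (fintype.subsetP PB).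
- by move=> i /[dup] /sub iB _; apply: chain => //; exact: jmax.
- by move=> i i' /sub iB /sub i'B; exact: chain.
Qed.
End Sections.

(** * Block optimality *)

Lemma sum_setU (R : nmodType) (I : finType) (A B : {set I}) (F : I -> R) :
  [disjoint A & B]%B ->
  \sum_(i in A :|: B) F i = \sum_(i in A) F i + \sum_(i in B) F i.
Proof. by move=> dAB; rewrite -bigU//; apply: eq_bigl => i; rewrite !inE. Qed.

Lemma natr_cardU (R : pzSemiRingType) (I : finType) (A B : {set I}) :
  [disjoint A & B]%B -> #|A :|: B|%:R = #|A|%:R + #|B|%:R :> R.
Proof. by move=> dAB; rewrite cardsU disjoint_setI0// cards0 subn0 natrD. Qed.

Section Blocks.
Context {R : realType} {p : nat} (psi : R -> R) (Z : set R) (y lam : 'rV[R]_p).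
Hypotheses (hpsi : admissible psi Z) (hlam : Kplus lam).
Implicit Types (A B P S : {set 'I_p}) (z u w : R).
Local Notation chi := (Defs.chi psi Z y lam).
Local Notation ybar := (block_mean y).
Local Notation lbar := (block_mean lam).
Local Notation card B := (#|B|%:R : R).
Local Notation lsum B := (\sum_(i in B) lam 0 i).
Local Notation ysum B := (\sum_(i in B) y 0 i).

(* Derivative in z of the objective on B of the constant vector z. *)
Definition grad B z : R := card B * z - ysum B + lsum B * derive1 psi z.

Lemma card_gt0R B : B != finset.set0 -> 0 < card B.
Proof. by rewrite ltr0n card_gt0. Qed.

Lemma gradE B z : B != finset.set0 -> grad B z = card B * (stat_input psi (lbar B) z - ybar B).
Proof.
move=> /card_gt0R B0; rewrite /grad /stat_input /block_mean; field.
by rewrite gt_eqF.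
Qed.

Lemma gradU A B z : [disjoint A & B]%B -> grad (A :|: B) z = grad A z + grad B z.
Proof.
by move=> dAB; rewrite /grad !sum_setU// natr_cardU//; ring.
Qed.

Lemma lbar_ge0 B : 0 <= lbar B.
Proof. by rewrite divr_ge0// sumr_ge0// => i _; case: hlam. Qed.

Lemma sum_scalar_obj B z : \sum_(i in B) scalar_obj psi (y 0 i) (lam 0 i) z =
  quad_obj psi (card B) (ysum B) (lsum B) z + \sum_(i in B) 2^-1 * y 0 i ^+ 2.
Proof.
under eq_bigr do rewrite scalar_objE.
rewrite big_split/=; congr (_ + _).
by rewrite /quad_obj big_split/= big_split/= sumrN -!mulr_suml sumr_const.
Qed.

(* The mean of lam on A is at least its mean on B, multiplied out so that the
   empty set is both heavier and lighter than any set. *)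
Definition heavier A B := card A * lsum B <= card B * lsum A.

(** Multiplied by [card B], the change of [grad A] is [card A] times that of [grad B] plus the
    excess weight of [A] times the decrease of [psi']. The same identity, with signs reversed, gives
    [le_grad_lighter]. *)
Lemma le_grad_heavier A B u w : 0 < card B -> heavier A B -> 0 < u -> u <= w ->
  grad B w <= grad B u -> grad A w <= grad A u.
Proof.
move=> B0 AB u0 uw BB; rewrite -subr_ge0 -(pmulr_rge0 _ B0).
have -> : card B * (grad A u - grad A w) = card A * (grad B u - grad B w) +
    (card B * lsum A - card A * lsum B) * (derive1 psi u - derive1 psi w).
  by rewrite /grad; ring.
have D := derive1_nonincreasing hpsi u0 uw.
by rewrite addr_ge0// mulr_ge0// ?subr_ge0.
Qed.

Lemma le_grad_lighter A B u w : 0 < card B -> heavier B A -> 0 < u -> u <= w ->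
  grad B u <= grad B w -> grad A u <= grad A w.
Proof.
move=> B0 AB u0 uw BB; rewrite -subr_ge0 -(pmulr_rge0 _ B0).
have -> : card B * (grad A w - grad A u) = card A * (grad B w - grad B u) +
    (card A * lsum B - card B * lsum A) * (derive1 psi u - derive1 psi w).
  by rewrite /grad; ring.
have D := derive1_nonincreasing hpsi u0 uw.
by rewrite addr_ge0// mulr_ge0// ?subr_ge0.
Qed.

Lemma heavier_lt A B : set_lt A B -> heavier A B.
Proof.
move=> /set_ltP AB; rewrite /heavier -subr_ge0.
(* The gap is a sum over pairs, each term non-negative because [lam] is non-increasing. *)
have -> : card B * lsum A - card A * lsum B =
    \sum_(i in A) \sum_(j in B) (lam 0 i - lam 0 j).
  have E i : \sum_(j in B) (lam 0 i - lam 0 j) = card B * lam 0 i - lsum B.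
    by rewrite sumrB sumr_const mulr_natl.
  under [RHS]eq_bigr do rewrite E.
  by rewrite sumrB -mulr_sumr sumr_const -(mulr_natl (lsum B)).
apply: sumr_ge0 => i iA; apply: sumr_ge0 => j jB; rewrite subr_ge0.
by case: hlam => + _; apply; exact/ltnW/AB.
Qed.

Lemma heavierU A A' B : [disjoint A & A']%B -> heavier A B -> heavier A' B ->
  heavier (A :|: A') B.
Proof.
move=> dA; rewrite /heavier !sum_setU// natr_cardU//.
by rewrite mulrDl mulrDr; exact: lerD.
Qed.

Lemma heavierUr A B B' : [disjoint B & B']%B -> heavier A B -> heavier A B' ->
  heavier A (B :|: B').
Proof.
move=> dB; rewrite /heavier !sum_setU// natr_cardU//.
by rewrite mulrDl mulrDr; exact: lerD.
Qed.

Local Notation prefix := (initial (@nat_of_ord p)).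

Lemma prefix_lt P B : prefix P B -> set_lt P (B :\: P).
Proof.
move=> [PB H]; apply/set_ltP => i j iP; rewrite inE => /andP[jP jB].
rewrite ltnNge; apply: contra jP; rewrite leq_eqVlt => /predU1P[/val_inj->//|].
exact: H iP jB.
Qed.

Lemma setUDid P B : P \subset B -> P :|: (B :\: P) = B.
Proof. by move=> PB; rewrite -[RHS](setID B P) (finset.setIidPr PB). Qed.

Lemma disjoint_setD P B : [disjoint P & B :\: P]%B.
Proof.
rewrite -setI_eq0; apply/eqP/setP => i; rewrite !inE.
by case: (i \in P); rewrite ?andbF.
Qed.

Lemma heavier_prefix P B : prefix P B -> heavier P B.
Proof.
move=> PB; rewrite -[X in heavier _ X](setUDid (proj1 PB)).
by apply: heavierUr; rewrite ?disjoint_setD//; [exact: lexx|exact/heavier_lt/prefix_lt].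
Qed.

Lemma heavier_suffix P B : prefix P B -> heavier B (B :\: P).
Proof.
move=> PB; rewrite -[X in heavier X _](setUDid (proj1 PB)).
by apply: heavierU; rewrite ?disjoint_setD//; [exact/heavier_lt/prefix_lt|exact: lexx].
Qed.

Lemma grad_split P B z : P \subset B -> grad B z = grad P z + grad (B :\: P) z.
Proof. by move=> PB; rewrite -gradU ?disjoint_setD// setUDid. Qed.

Lemma chi_prox B : chi B = prox psi Z (ybar B) (lbar B).
Proof. by []. Qed.

Lemma chi_ge0 B : 0 <= chi B.
Proof. by rewrite chi_prox prox_ge0// lbar_ge0. Qed.

Lemma grad_chi_ge0 B z : B != finset.set0 -> 0 < z -> chi B <= z -> 0 <= grad B z.
Proof.
move=> B0 z0 Bz; rewrite gradE// mulr_ge0// subr_ge0.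
by apply: prox_le_stat Bz => //; exact: lbar_ge0.
Qed.

Lemma m_le_chi B : 0 < chi B -> m psi Z (lbar B) <= chi B.
Proof. by move=> v0; case: (prox_gt0 hpsi (lbar_ge0 B) v0). Qed.

Lemma grad_chi_le0 B : B != finset.set0 -> 0 < chi B -> grad B (chi B) <= 0.
Proof.
move=> B0 v0; rewrite gradE// pmulr_rle0 ?card_gt0R// subr_le0.
by case: (prox_gt0 hpsi (lbar_ge0 B) v0).
Qed.

Lemma grad_nondecreasing B u w : B != finset.set0 -> m psi Z (lbar B) <= u -> 0 < u -> u <= w ->
  grad B u <= grad B w.
Proof.
move=> B0 mu u0 uw; rewrite !gradE// ler_pM2l ?card_gt0R// lerD2r.
by apply: (stat_nondecreasing hpsi) mu _ _ => //; exact: lbar_ge0.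
Qed.

Lemma grad_nonincreasing B u w : B != finset.set0 -> 0 < u -> u <= w -> w <= m psi Z (lbar B) ->
  grad B w <= grad B u.
Proof.
move=> B0 u0 uw wm; rewrite !gradE// ler_pM2l ?card_gt0R// lerD2r.
by apply: (stat_nonincreasing hpsi) wm => //; exact: lbar_ge0.
Qed.

(* The invariant of the PAV algorithm. The dual condition on suffixes,
   grad S (chi B) <= 0, follows from it by grad_split and grad_chi_le0. *)
Definition prefix_stationary B :=
  forall P z, prefix P B -> 0 < z -> chi B <= z -> 0 <= grad P z.

Lemma grad0 z : grad finset.set0 z = 0.
Proof. by rewrite /grad cards0 !big_set0; ring. Qed.

Lemma prefix_stationary1 (i : 'I_p) : prefix_stationary [set i].
Proof.
move=> P z [Pi _] z0 vz; move: Pi; rewrite subset1 => /orP[]/eqP->.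
  by apply: grad_chi_ge0 => //; apply/set0Pn; exists i; rewrite inE.
by rewrite grad0.
Qed.

(** A prefix of the union is either a prefix of [B1] or all of [B1] with a prefix of [B2]. The old
    invariants settle [z] above the old values; the work is for [z] between the new value and an old
    one. *)
Lemma prefix_stationaryU B1 B2 : B1 != finset.set0 -> B2 != finset.set0 -> set_lt B1 B2 ->
  prefix_stationary B1 -> prefix_stationary B2 -> chi B1 <= chi B2 ->
  prefix_stationary (B1 :|: B2).
Proof.
move=> B10 B20 lt12 st1 st2 v12 P z Ppre z0 vz.
have dB : [disjoint B1 & B2]%B.
  rewrite -setI_eq0; apply/eqP/setP => i; rewrite !inE; apply/negP => /andP[i1 i2].
  by have /set_ltP/(_ _ _ i1 i2) := lt12; rewrite ltnn.
have B120 : B1 :|: B2 != finset.set0 by rewrite finset.setU_eq0 negb_and B10.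
have ge12 t : 0 < t -> chi (B1 :|: B2) <= t -> 0 <= grad (B1 :|: B2) t.
  exact: grad_chi_ge0.
have [PB Pini] := Ppre.
have [P2|[i2 /setIP[i2P i2B]]] := set_0Vmem (P :&: B2).
  have P1 : prefix P B1.
    split; last by move=> i j iP jB; apply: Pini => //; rewrite inE jB.
    apply/fintype.subsetP => i iP; have := fintype.subsetP PB _ iP; rewrite inE => /orP[//|i2].
    by have : i \in P :&: B2 by [rewrite inE iP]; rewrite P2 inE.
  have [v1z|zv1] := leP (chi B1) z; first exact: st1.
  (* At the jump of the rule the new value may drop below chi B1: there
     grad (B1 :|: B2) z >= 0 >= grad (B1 :|: B2) (chi B1), and this order is
     inherited by the heavier set P. *)
  have v1 : 0 < chi B1 by exact: lt_trans zv1.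
  have g12 : grad (B1 :|: B2) (chi B1) <= 0.
    rewrite gradU//; apply: ler_wnDl; first exact: grad_chi_le0.
    apply: le_trans (grad_chi_le0 B20 (lt_le_trans v1 v12)).
    (* Both values lie in the convex region of [B1], so its gradient does not decrease between them;
       the lighter [B2] inherits this. *)
    apply: (le_grad_lighter (card_gt0R B10) (heavier_lt lt12) v1 v12).
    exact: grad_nondecreasing B10 (m_le_chi v1) v1 v12.
  apply: le_trans (st1 P (chi B1) P1 v1 (lexx _)) _.
  apply: (le_grad_heavier (card_gt0R B120) (heavier_prefix Ppre) z0 (ltW zv1)).
  by apply: le_trans g12 _; exact: ge12.
have B1P : B1 \subset P.
  apply/fintype.subsetP => j j1; apply: (Pini i2) => //; first by rewrite inE j1.
  by have /set_ltP := lt12; exact.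
set P2 := P :&: B2.
have P2pre : prefix P2 B2.
  split; first exact: subsetIr.
  move=> i j /setIP[iP i2'] j2 ji; rewrite inE j2 andbT.
  by apply: Pini ji => //; rewrite inE j2 orbT.
have dP : [disjoint B1 & P2]%B by apply: disjointWr dB; exact: subsetIr.
have PE : P = B1 :|: P2.
  apply/setP => i; rewrite !inE; apply/idP/orP => [iP|[/(fintype.subsetP B1P)//|/andP[]//]].
  by have := fintype.subsetP PB _ iP; rewrite inE iP => /orP[]; [left|right].
have [v2z|zv2] := leP (chi B2) z.
  rewrite PE gradU// addr_ge0//; last exact: st2.
  by apply: st1 => //; exact: le_trans v2z.
have v2 : 0 < chi B2 by exact: lt_trans zv2.
(* Here [grad P] is the gradient of the union minus that of the suffix [B2 :\: P2]. The latter is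
   non-positive at [chi B2] and, the suffix being lighter than [B2], no larger at [t]. *)
have claim t : 0 < t -> chi (B1 :|: B2) <= t -> m psi Z (lbar B2) <= t -> t <= chi B2 ->
    0 <= grad P t.
  move=> t0 vt mt tv2.
  have : grad (B2 :\: P2) t <= 0.
    apply: (@le_trans _ _ (grad (B2 :\: P2) (chi B2))).
      apply: (le_grad_lighter (B := B2)) => //; first exact: card_gt0R.
        exact: heavier_suffix.
      exact: grad_nondecreasing.
    have := grad_chi_le0 B20 v2; rewrite (grad_split _ (proj1 P2pre)).
    have := st2 P2 _ P2pre v2 (lexx _); lra.
  have := ge12 t t0 vt; rewrite gradU// (grad_split _ (proj1 P2pre)) PE gradU//; lra.
(* Left of the convex region of B2, the derivative of B2, hence that of the
   heavier set P, is at least its value at m. *)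
have [mz|zm] := leP (m psi Z (lbar B2)) z; first exact: claim (ltW zv2).
have mv := m_le_chi v2.
apply: le_trans (claim (m psi Z (lbar B2)) _ _ _ _) _ => //.
- exact: lt_trans zm.
- exact: le_trans (ltW zm).
- apply: (le_grad_heavier (B := B2)) => //; rewrite ?card_gt0R// ?(ltW zm)//.
    by rewrite PE; apply: heavierU => //; [exact: heavier_lt|exact: heavier_prefix].
  by apply: grad_nonincreasing => //; exact: ltW.
Qed.

(** If [chi B] were [m], the inequalities of [prox_gt0] and [prox_le_stat] would meet and put the
    mean of [y] exactly at [tau]. *)
Lemma m_lt_chi B : B != finset.set0 -> ~ at_jump psi Z y lam B -> 0 < chi B ->
  m psi Z (lbar B) < chi B.
Proof.
move=> B0 nj v0; have [mv sv tv] := prox_gt0 hpsi (lbar_ge0 B) v0.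
rewrite lt_neqAle mv andbT; apply/eqP => e; apply: nj.
rewrite /at_jump e; split => //; rewrite tv//; congr (_%:E).
apply/eqP; rewrite eq_le sv andbT.
exact: (prox_le_stat hpsi (lbar_ge0 B) v0 (lexx _)).
Qed.

Lemma block_minimizer B (x : 'I_p -> R) : B != finset.set0 -> prefix_stationary B ->
  (forall i j, i \in B -> j \in B -> (i <= j)%N -> x j <= x i) ->
  (forall i, i \in B -> 0 <= x i) ->
  (0 < chi B -> forall i, i \in B -> m psi Z (lbar B) <= x i) ->
  \sum_(i in B) scalar_obj psi (y 0 i) (lam 0 i) (chi B) <=
  \sum_(i in B) scalar_obj psi (y 0 i) (lam 0 i) (x i).
Proof.
move=> B0 st dx x0 mx; set v := chi B; have v0 : 0 <= v := chi_ge0 B.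
pose F i z := scalar_obj psi (y 0 i) (lam 0 i) z.
have up : \sum_(i in B) F i v <= \sum_(i in B) F i (Num.max (x i) v).
  apply: (sum_le_initial (k := @nat_of_ord p) (r := fun a b => v <= a /\ a <= b)).
  - move=> P a b PB [va ab]; rewrite /F !sum_scalar_obj lerD2r.
    apply: (le_quad_obj hpsi) => //; first exact: le_trans va.
    move=> z /andP[az zb]; apply: st => //; last exact: le_trans (ltW az).
    by apply: le_lt_trans az; exact: le_trans va.
  - by move=> i _; rewrite le_max lexx orbT.
  - move=> i j iB jB ij; rewrite le_max lexx orbT; split => //.
    by rewrite ge_max le_max dx//= le_max lexx orbT.
have down : \sum_(i in B) F i v <= \sum_(i in B) F i (Num.min (x i) v).
  (* When [v = 0], feasibility gives [min (x i) v = v], so nothing moves down. *)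
  have [e|vn0] := eqVneq v 0.
    by apply: ler_sum => i iB; rewrite e min_r ?x0.
  have vp : 0 < v by rewrite lt0r vn0.
  (* Ranking by [p - i] turns initial sections into suffixes. The bound by [m] in the relation keeps
     every move in the convex region of [B]. *)
  apply: (sum_le_initial (k := fun i : 'I_p => (p - i)%N)
    (r := fun a b => [/\ m psi Z (lbar B) <= b, b <= a & a <= v])).
  - move=> S a b [SB Sini] [mb ba av]; rewrite /F !sum_scalar_obj lerD2r.
    have b0 : 0 <= b by apply: le_trans mb; exact: m_ge0.
    apply: (ge_quad_obj hpsi) => // z /andP[bz za].
    have zp : 0 < z by exact: le_lt_trans bz.
    have zv : z <= v by exact: le_trans (ltW za) av.
    have pre : prefix (B :\: S) B.
      split; first exact: subsetDl.
      move=> i j /setDP[iB iS] jB ji; rewrite inE jB andbT.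
      apply: contra iS => jS; apply: Sini jS iB _.
      exact: ltn_sub2l (ltn_ord j) ji.
    have SE : B :\: (B :\: S) = S by rewrite finset.setDDr finset.setDv finset.set0U; apply/finset.setIidPr.
    apply: (@le_trans _ _ (grad S v)).
      apply: (le_grad_lighter (B := B)) => //; first exact: card_gt0R.
        by rewrite -SE; exact: heavier_suffix.
      by apply: grad_nondecreasing => //; exact: le_trans (ltW bz).
    have := grad_chi_le0 B0 vp; rewrite (grad_split _ (proj1 pre)) SE.
    by have := st _ _ pre vp (lexx _); rewrite -/v; lra.
  - by move=> i iB; split => //; rewrite ?ge_min ?lexx ?orbT// le_min mx//= m_le_chi.
  - move=> i j iB jB ij; split.
    + by rewrite le_min mx//= m_le_chi.
    + rewrite le_min !ge_min lexx orbT andbT dx//.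
      by rewrite leqNgt; apply/negP => /(ltn_sub2l (ltn_ord i)); rewrite ltnNge ij.
    + by rewrite ge_min lexx orbT.
(* At each index, the maximum and the minimum are [x i] and [v] in some order. *)
have : \sum_(i in B) F i (x i) + \sum_(i in B) F i v =
    \sum_(i in B) F i (Num.max (x i) v) + \sum_(i in B) F i (Num.min (x i) v).
  rewrite -!big_split/=; apply: eq_bigr => i _.
  by case: (leP (x i) v) => // _; rewrite addrC.
by move: up down; rewrite /F; lra.
Qed.
End Blocks.

(** * Local optimality, block by block *)

Theorem mainTheorem2 (R : realType) (p : nat) (psi : R -> R) (Z : set R)
    (y lam : 'rV[R]_p)
    (hpsi : admissible psi Z)
    (hlam : Kplus lam) (hlam_strict : has_strict_ineq lam)
    (hy : Kplus y)
    (hjump : forall c, c \in pav_partition (chi psi Z y lam) ->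
               ~ at_jump psi Z y lam c.1) :
  local_minimizer Kplus (objective psi y lam) (pav (chi psi Z y lam)).
Proof.
set upd := chi psi Z y lam; set s := pav_partition upd.
pose good (B : {set 'I_p}) := B != finset.set0 /\ prefix_stationary psi Z y lam B.
have [[scell spw scov] ssort] : ordered_cells upd good s /\
    sorted (fun c c' => c'.2 <= c.2) s.
  apply: pav_partition_ordered => [i|B1 B2 [B10 st1] [B20 st2] lt12 v12].
    split; last exact: prefix_stationary1.
    by apply/set0Pn; exists i; rewrite inE.
  split; first by rewrite finset.setU_eq0 negb_and B10.
  exact: prefix_stationaryU.
have pavE c i : c \in s -> i \in c.1 -> pav upd 0 i = c.2.
  move=> cs ic; rewrite mxE (ordered_sum (fun d => Num.max 0 d.2) spw cs ic).
  by have [-> _] := scell c cs; rewrite max_r// chi_ge0.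
have K : Kplus (pav upd).
  split=> [i j ij|i]; have [c cs ic] := scov i; rewrite (pavE c i)//.
    by have [d ds jd] := scov j; rewrite (pavE d j)//; exact: (ordered_val spw ssort cs ds ic jd ij).
  by have [-> _] := scell c cs; exact: chi_ge0.
split => //.
have sumE (F : 'I_p -> R) : \sum_(i < p) F i = \sum_(c <- s) \sum_(i in c.1) F i.
  rewrite (exchange_big_dep predT)//=; apply: eq_bigr => i _.
  have [c cs ic] := scov i.
  by rewrite (ordered_sum (fun=> F i) spw cs ic).
have objE x : objective psi y lam x =
    \sum_(c <- s) \sum_(i in c.1) scalar_obj psi (y 0 i) (lam 0 i) (x 0 i).
  by rewrite -sumE /objective mulr_sumr -big_split.
(* One condition per coordinate: each holds near the output by [m_lt_chi] and continuity of the
   coordinate, and finitely many such neighborhoods intersect in one. *)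
pose above_m (i : 'I_p) : set 'rV[R]_p := [set x | forall c, c \in s -> i \in c.1 ->
  0 < c.2 -> m psi Z (block_mean lam c.1) <= x 0 i].
have near_m : \forall x \near pav upd, forall i, above_m i x.
  apply: (@filter_forall _ _ above_m (nbhs (pav upd)) (nbhs_filter _)) => i; have [c cs ic] := scov i.
  (* The indicator of [c], summed over the cells containing [i], equals both its value at [d] and
     its value 1 at [c]. *)
  have uniq d : d \in s -> i \in d.1 -> d = c.
    move=> ds id.
    have := ordered_sum (fun e => (e == c)%:R : R) spw cs ic.
    rewrite (ordered_sum (fun e => (e == c)%:R : R) spw ds id) eqxx.
    by have [//|_ /esym/eqP] := eqVneq d c; rewrite oner_eq0.
  have [v0|v0] := leP c.2 0.
    by apply: (@filterE _ (nbhs (pav upd)) (nbhs_filter _)) => x d ds id; rewrite (uniq d)// ltNge v0.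
  have [cv [c0 _]] := scell c cs.
  have mv : m psi Z (block_mean lam c.1) < pav upd 0 i.
    rewrite (pavE c)// cv; apply: m_lt_chi => //; first exact: hjump.
    by rewrite -/upd -cv.
  have /cvgr_gt/(_ _ mv) H := @coord_continuous R 1 p 0 i (pav upd).
  apply: (@filterS _ (nbhs (pav upd)) (nbhs_filter _) _ _ _ H) => x mx d ds id _.
  by rewrite (uniq d)//; exact: ltW.
apply: (@filterS _ (nbhs (pav upd)) (nbhs_filter _) _ _ _ near_m) => x mx Kx.
rewrite !objE !big_seq; apply: ler_sum => c cs.
have [cv [c0 st]] := scell c cs.
rewrite (eq_bigr (fun i => scalar_obj psi (y 0 i) (lam 0 i) (upd c.1))); last first.
  by move=> i ic; rewrite (pavE c)// cv.
apply: block_minimizer => //.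
- by move=> i j _ _; case: Kx => + _; exact.
- by move=> i _; case: Kx.
- by move=> v0 i ic; apply: (mx i c cs ic); rewrite cv.
Qed.
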